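(* Let $G\in\mathcal M_{N,K}$ and $\eta>0$. Suppose that $$\Phi_{sum}^\eta(G)<2+(N^2-2)\exp\!\left(\eta\left(\frac{K}{N^2-2}-\frac{K^2}{N(N^2-2)}+\frac{K(N-K)}{N(N-1)(N^2-2)}\right)\right).$$ Then $G$ contains no zero entries.
   Context: Let $\mathbb F=\mathbb R$ or $\mathbb C$, and let $K,N$ be integers with $1\le K\le N$, $N\ge2$. $\mathcal M_{N,K}=\{G\in\mathbb F^{N\times N}: G=G^2=G^*,\ \mathrm{tr}(G)=K\}$. $C_{N,K}=\sqrt{\frac{K(N-K)}{N^2(N-1)}}$. The sum potential of $G=(G_{a,b})\in\mathcal M_{N,K}$ is $\Phi_{sum}^\eta(G)=\sum_{j\ne l}e^{\eta|G_{j,l}|^2}+\sum_{j=1}^N e^{-\eta(K^2/N^2-C_{N,K}^2)}e^{\eta|G_{j,j}|^2}$. *)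

(* Defs.v *)
From mathcomp Require Import all_boot all_order all_algebra complex.
From mathcomp Require Import classical_sets reals sequences exp.

Set Implicit Arguments.
Unset Strict Implicit.
Unset Printing Implicit Defensive.

Import Order.TTheory GRing.Theory Num.Theory.

Local Open Scope classical_set_scope.
Local Open Scope ring_scope.

Inductive scalar_kind := RealScalars | ComplexScalars.

Definition scalar_field (R : realType) (k : scalar_kind) : numFieldType :=
  match k with
  | RealScalars => R
  | ComplexScalars => R[i]
  end.

Definition sconj (R : realType) (k : scalar_kind) : scalar_field R k -> scalar_field R k :=
  match k with
  | RealScalars => fun x : R => x
  | ComplexScalars => fun z : R[i] => conjc z
  end.

(* The norm of R[i] supplied by its numFieldType structure takes values in R[i];
   the modulus below is valued in R. *)
Definition smod (R : realType) (k : scalar_kind) : scalar_field R k -> R :=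
  match k with
  | RealScalars => fun x : R => `|x|
  | ComplexScalars => fun z : R[i] => ComplexField.Normc.normc z
  end.

Definition adjmx (R : realType) (k : scalar_kind) (m n : nat)
    (A : 'M[scalar_field R k]_(m, n)) : 'M[scalar_field R k]_(n, m) :=
  (map_mx (@sconj R k) A)^T.

Definition projections (R : realType) (k : scalar_kind) (N K : nat) :
    set 'M[scalar_field R k]_N :=
  [set G | [/\ G = G *m G, G = adjmx G & \tr G = K%:R]].

Arguments projections : clear implicits.

Definition welch_const (R : realType) (N K : nat) : R :=
  Num.sqrt (K%:R * (N%:R - K%:R) / (N%:R ^+ 2 * (N%:R - 1))).

Definition sum_potential (R : realType) (k : scalar_kind) (N K : nat) (eta : R)
    (G : 'M[scalar_field R k]_N) : R :=
  \sum_(j < N) \sum_(l < N | j != l) expR (eta * smod (G j l) ^+ 2)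
  + \sum_(j < N)
      expR (- eta * (K%:R ^+ 2 / N%:R ^+ 2 - welch_const R N K ^+ 2))
      * expR (eta * smod (G j j) ^+ 2).

(* Main.v *)
Require Import Defs.
From mathcomp Require Import all_boot all_order all_algebra complex.
From mathcomp Require Import classical_sets reals sequences exp.
From mathcomp Require Import ring.

Set Implicit Arguments.
Unset Strict Implicit.
Unset Printing Implicit Defensive.

Import Order.TTheory GRing.Theory Num.Theory.

Local Open Scope ring_scope.

(** The argument is Jensen's inequality with two terms set aside.  Absorbing the
    diagonal weight into the exponent, the potential is the sum over all [N ^ 2]
    index pairs of [expR] of an exponent ([sum_potentialE]).  The exponents have
    a total which does not depend on [G], because the squared moduli of the
    entries of a projection of trace [K] add up to [K]
    ([projection_sum_sqr_smod]).  If an off-diagonal entry vanishes, then so does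
    its mirror image, as [G] is self-adjoint; these two entries have exponent 0
    and contribute exactly 2 to the potential, without using up any of the
    total.  By convexity of [expR] ([expR_jensen]) the other [N ^ 2 - 2] terms
    add up to at least [N ^ 2 - 2] times the exponential of their mean exponent,
    which is the bound that the hypothesis excludes.

    A vanishing diagonal entry reduces to this case: a diagonal entry of a
    projection is the squared norm of its row ([projection_row_norm]), so the
    whole row vanishes, and for [N >= 2] it has an off-diagonal entry. *)

(** * Scalars *)

(** The diagonal entries and the trace of a projection live in the scalar field
    whereas moduli live in [R]; taking real parts brings an identity of the
    former kind to the latter. *)
Definition sre (R : realType) (k : scalar_kind) : scalar_field R k -> R :=
  match k with
  | RealScalars => fun x : R => x
  | ComplexScalars => fun z : R[i] => complex.Re z
  end.

Lemma sre0 (R : realType) (k : scalar_kind) : sre (0 : scalar_field R k) = 0.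
Proof. by case: k. Qed.

Lemma sreD (R : realType) (k : scalar_kind) : {morph @sre R k : x y / x + y}.
Proof. by case: k => //= -[a b] [c d]. Qed.

Lemma sre_sum (R : realType) (k : scalar_kind) (I : Type) (r : seq I)
    (P : pred I) (F : I -> scalar_field R k) :
  sre (\sum_(i <- r | P i) F i) = \sum_(i <- r | P i) sre (F i).
Proof. exact: (big_morph _ (@sreD R k) (sre0 R k)). Qed.

Lemma sre_nat (R : realType) (k : scalar_kind) (n : nat) :
  sre (n%:R : scalar_field R k) = n%:R.
Proof.
elim: n => [|n IHn]; first exact: sre0.
by rewrite -addn1 !natrD sreD IHn; case: k {IHn}.
Qed.

Lemma sre_mul_sconj (R : realType) (k : scalar_kind) (z : scalar_field R k) :
  sre (z * sconj z) = smod z ^+ 2.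
Proof.
case: k z => /= [z|[a b]]; first by rewrite real_normK ?num_real // expr2.
by rewrite /= sqr_sqrtr ?addr_ge0 ?sqr_ge0 //; ring.
Qed.

Lemma sconj0 (R : realType) (k : scalar_kind) :
  sconj (0 : scalar_field R k) = 0.
Proof. by case: k => //=; exact: conjc0. Qed.

Lemma smod0 (R : realType) (k : scalar_kind) :
  smod (0 : scalar_field R k) = 0.
Proof. by case: k => /=; [rewrite normr0 | exact: ComplexField.Normc.normc0]. Qed.

Lemma smod_eq0 (R : realType) (k : scalar_kind) (z : scalar_field R k) :
  smod z = 0 -> z = 0.
Proof.
by case: k z => /= z; [exact: normr0_eq0 | exact: ComplexField.Normc.eq0_normc].
Qed.

(** * Entries of a projection *)

Lemma projection_entry_sym (R : realType) (k : scalar_kind) (N K : nat)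
    (G : 'M[scalar_field R k]_N) (j l : 'I_N) :
  projections R k N K G -> G l j = sconj (G j l).
Proof. by case=> _ GE _; rewrite [in LHS]GE /adjmx !mxE. Qed.

(** Entrywise form of [G = G *m adjmx G]. *)
Lemma projection_row_norm (R : realType) (k : scalar_kind) (N K : nat)
    (G : 'M[scalar_field R k]_N) (j : 'I_N) :
  projections R k N K G -> sre (G j j) = \sum_(l < N) smod (G j l) ^+ 2.
Proof.
move=> hG; have [GG _ _] := hG.
rewrite [in LHS]GG mxE sre_sum; apply: eq_bigr => l _.
by rewrite (projection_entry_sym j l hG) sre_mul_sconj.
Qed.

Lemma projection_diag_eq0 (R : realType) (k : scalar_kind) (N K : nat)
    (G : 'M[scalar_field R k]_N) (j l : 'I_N) :
  projections R k N K G -> G j j = 0 -> G j l = 0.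
Proof.
move=> hG Gjj0; apply/smod_eq0/eqP; rewrite -sqrf_eq0.
have /eqP := projection_row_norm j hG.
rewrite Gjj0 sre0 eq_sym psumr_eq0; last by move=> i _; exact: sqr_ge0.
by move/allP/(_ l (mem_index_enum l)).
Qed.

Lemma projection_sum_sqr_smod (R : realType) (k : scalar_kind) (N K : nat)
    (G : 'M[scalar_field R k]_N) :
  projections R k N K G -> \sum_(j < N) \sum_(l < N) smod (G j l) ^+ 2 = K%:R.
Proof.
move=> hG; have [_ _ trG] := hG.
rewrite -(sre_nat R k) -trG /mxtrace sre_sum; apply: eq_bigr => j _.
by rewrite (projection_row_norm _ hG).
Qed.

(** * The potential as a sum of exponentials *)

(** Jensen's inequality, with the mean given as a parameter [m] so that no
    division by the number of terms occurs.  Each term lies above the tangent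
    line of [expR] at [m], and the linear parts of these bounds cancel in the
    sum. *)
Lemma expR_jensen (R : realType) (I : finType) (A : pred I) (x : I -> R) (m : R) :
  \sum_(i in A) x i = #|A|%:R * m ->
  #|A|%:R * expR m <= \sum_(i in A) expR (x i).
Proof.
move=> sumx.
have tangent i : expR m * (1 + (x i - m)) <= expR (x i).
  have -> : expR (x i) = expR m * expR (x i - m) by rewrite -expRD addrC subrK.
  by rewrite ler_wpM2l ?expR_ge0 // expR_ge1Dx.
apply: le_trans (ler_sum _ (fun i _ => tangent i)).
by rewrite -mulr_sumr big_split /= sumrB sumx !sumr_const -[m *+ _]mulr_natl subrr
           addr0 mulrC.
Qed.

(** The diagonal weight of the potential, moved into the exponent. *)
Definition potential_exponent (R : realType) (k : scalar_kind) (N K : nat)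
    (eta : R) (G : 'M[scalar_field R k]_N) (j l : 'I_N) : R :=
  eta * (smod (G j l) ^+ 2
         - (K%:R ^+ 2 / N%:R ^+ 2 - welch_const R N K ^+ 2) *+ (l == j)).

Lemma sum_potentialE (R : realType) (k : scalar_kind) (N K : nat) (eta : R)
    (G : 'M[scalar_field R k]_N) :
  sum_potential K eta G =
  \sum_(j < N) \sum_(l < N) expR (potential_exponent K eta G j l).
Proof.
rewrite /sum_potential -big_split /=; apply: eq_bigr => j _.
rewrite [RHS](bigD1 j) //= addrC /potential_exponent eqxx; congr (_ + _).
  by rewrite -expRD mulr1n; congr expR; ring.
apply: eq_big => [l|l jl]; first by rewrite eq_sym.
by rewrite eq_sym (negbTE jl) mulr0n subr0.
Qed.

Lemma sum_potential_exponent (R : realType) (k : scalar_kind) (N K : nat)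
    (eta : R) (G : 'M[scalar_field R k]_N) :
  projections R k N K G ->
  \sum_(j < N) \sum_(l < N) potential_exponent K eta G j l =
  eta * (K%:R - N%:R * (K%:R ^+ 2 / N%:R ^+ 2 - welch_const R N K ^+ 2)).
Proof.
rewrite /potential_exponent; set c := K%:R ^+ 2 / _ - _ => hG.
rewrite -(projection_sum_sqr_smod hG).
transitivity (\sum_(j < N) eta * (\sum_(l < N) smod (G j l) ^+ 2 - c)).
  apply: eq_bigr => j _; rewrite -mulr_sumr sumrB; congr (_ * (_ - _)).
  by rewrite (bigD1 j) //= eqxx big1 ?addr0 // => l /negbTE ->.
by rewrite -mulr_sumr sumrB sumr_const card_ord mulr_natl.
Qed.

Lemma sqr_welch_const (R : realType) (N K : nat) : (1 <= N)%N -> (K <= N)%N ->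
  welch_const R N K ^+ 2 =
  K%:R * (N%:R - K%:R) / (N%:R ^+ 2 * (N%:R - 1)).
Proof.
move=> N1 KN; rewrite sqr_sqrtr // divr_ge0 // mulr_ge0 ?sqr_ge0 //.
- by rewrite subr_ge0 ler_nat.
- by rewrite subr_ge0 ler1n.
Qed.

(** * A vanishing off-diagonal entry *)

(** The mean of the exponents other than the two vanishing ones is the exponent
    in this bound. *)
Lemma sum_potential_offdiag0 (R : realType) (k : scalar_kind) (N K : nat)
    (eta : R) (G : 'M[scalar_field R k]_N) (j l : 'I_N) :
  (K <= N)%N -> (2 <= N)%N -> projections R k N K G -> j != l -> G j l = 0 ->
  2 + (N%:R ^+ 2 - 2) *
      expR (eta * (K%:R / (N%:R ^+ 2 - 2)
                   - K%:R ^+ 2 / (N%:R * (N%:R ^+ 2 - 2))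
                   + K%:R * (N%:R - K%:R)
                     / (N%:R * (N%:R - 1) * (N%:R ^+ 2 - 2))))
  <= sum_potential K eta G.
Proof.
move=> KN N2 hG jl Gjl0.
have Glj0 : G l j = 0.
  by rewrite (projection_entry_sym j l hG) Gjl0 sconj0.
pose x (p : 'I_N * 'I_N) := potential_exponent K eta G p.1 p.2.
have xjl : x (j, l) = 0.
  by rewrite /x /potential_exponent /= Gjl0 smod0 expr0n /= eq_sym (negbTE jl)
             subr0 mulr0.
have xlj : x (l, j) = 0.
  by rewrite /x /potential_exponent /= Glj0 smod0 expr0n /= (negbTE jl)
             subr0 mulr0.
pose Z : {set 'I_N * 'I_N} := [set (j, l); (l, j)].
have split2 (F : 'I_N * 'I_N -> R) :
    \sum_p F p = F (j, l) + F (l, j) + \sum_(p in ~: Z) F p.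
  rewrite (bigID [in Z]) /=; congr (_ + _); last first.
    by apply: eq_bigl => p; rewrite finset.in_setC.
  by rewrite big_setU1 /= ?big_set1 // inE xpair_eqE negb_and jl.
have cardZC : #|~: Z|%:R = N%:R ^+ 2 - 2 :> R.
  have cZ : #|Z| = 2%N by rewrite cards2 xpair_eqE negb_and jl.
  have := cardsC Z; rewrite cZ card_prod card_ord => cZC.
  by rewrite expr2 -natrM -cZC natrD addrAC subrr add0r.
have n0 : N%:R != 0 :> R by rewrite pnatr_eq0 -lt0n ltnW.
have n1 : N%:R - 1 != 0 :> R by rewrite subr_eq0 (eqr_nat R N 1) gtn_eqF.
have n2 : N%:R ^+ 2 - 2 != 0 :> R.
  by rewrite subr_eq0 -natrX eqr_nat gtn_eqF // (@leq_trans (2 ^ 2)) // leq_exp2r.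
rewrite sum_potentialE pair_big /= (split2 (fun p => expR (x p))) xjl xlj expR0.
rewrite -[X in X + _ <= _](natrD _ 1 1) lerD2l -cardZC.
apply: expR_jensen; rewrite cardZC.
have := sum_potential_exponent eta hG.
rewrite pair_big /= (split2 x) xjl xlj !add0r => ->.
rewrite sqr_welch_const ?(ltnW N2) //.
by field; rewrite n0 n1 n2.
Qed.

Theorem proposition4p12 (R : realType) (k : scalar_kind) (N K : nat)
    (hK : (1 <= K <= N)%N) (hN : (2 <= N)%N)
    (G : 'M[scalar_field R k]_N) (hG : projections R k N K G)
    (eta : R) (heta : 0 < eta)
    (hPhi : sum_potential K eta G <
      2 + (N%:R ^+ 2 - 2) *
          expR (eta * (K%:R / (N%:R ^+ 2 - 2)
                       - K%:R ^+ 2 / (N%:R * (N%:R ^+ 2 - 2))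
                       + K%:R * (N%:R - K%:R)
                         / (N%:R * (N%:R - 1) * (N%:R ^+ 2 - 2))))) :
  forall j l : 'I_N, G j l != 0.
Proof.
have [_ KN] := andP hK.
have offdiag (j l : 'I_N) : j != l -> G j l != 0.
  move=> jl; apply/eqP => Gjl0; move: hPhi; rewrite ltNge.
  by rewrite (sum_potential_offdiag0 eta KN hN hG jl Gjl0).
move=> j l; have [<-|] := eqVneq j l; last exact: offdiag.
have [i ji] : exists i : 'I_N, j != i.
  have : (0 < #|predC1 j|)%N by rewrite cardC1 card_ord -ltnS prednK // ltnW.
  by case/card_gt0P => i; rewrite inE eq_sym; exists i.
apply: contra (offdiag j i ji) => /eqP Gjj0.
by apply/eqP; exact: (projection_diag_eq0 _ hG Gjj0).
Qed.
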